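(* Let $k$ be a positive integer and $n_0,\ldots,n_{k-1}$ positive integers, with indices read modulo $k$. For each $j\in\{0,\ldots,k-1\}$ let $A^{(j)}$ be a real $n_j\times n_{j+1}$ matrix. Then every matrix in $\mathcal{Q}(A^{(0)})\mathcal{Q}(A^{(1)})\cdots\mathcal{Q}(A^{(k-1)})$ is a $P_0$-matrix if and only if the signed digraph $G_{A^{(0)}A^{(1)}\cdots A^{(k-1)}}$ is e-cycle-free.
   Context: Indices $j$ are taken modulo $k$. For a real matrix $M$, the qualitative class $\mathcal{Q}(M)$ is the set of real matrices $X$ of the same dimensions with $M_{ij}>0\Rightarrow X_{ij}>0$, $M_{ij}<0\Rightarrow X_{ij}<0$, $M_{ij}=0\Rightarrow X_{ij}=0$. The set $\mathcal{Q}(A^{(0)})\cdots\mathcal{Q}(A^{(k-1)})$ is $\{B^{(0)}B^{(1)}\cdots B^{(k-1)} : B^{(j)}\in\mathcal{Q}(A^{(j)})\}$. The signed digraph $G=G_{A^{(0)}\cdots A^{(k-1)}}$ has vertex set the disjoint union of sets $V_0,\ldots,V_{k-1}$ with $V_j=\{V_j^1,\ldots,V_j^{n_j}\}$; there is a directed edge from $V_j^r$ to $V_{j+1}^s$ iff $(A^{(j)})_{rs}\neq 0$, with sign equal to the sign of $(A^{(j)})_{rs}$; there are no other edges (for $k=1$, loops are allowed). Every directed cycle in $G$ has length a multiple of $k$. A directed cycle with $kr_1$ edges, of which $r_2$ are negative, is an e-cycle if $(-1)^{r_1+r_2}=1$ and an o-cycle otherwise; $G$ is e-cycle-free if it has no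 e-cycle. A $P_0$-matrix is a real square matrix all of whose principal minors are nonnegative. *)

(* Defs.v *)
From HB Require Import structures.
From mathcomp Require Import all_boot all_order all_algebra.
From mathcomp Require Import reals.
Set Implicit Arguments. Unset Strict Implicit. Unset Printing Implicit Defensive.
Import Order.TTheory GRing.Theory Num.Theory.
Local Open Scope ring_scope.

Definition qual (R : realType) (p q : nat) (M X : 'M[R]_(p, q)) : Prop :=
  forall i j,
    (0 < M i j -> 0 < X i j) /\ (M i j < 0 -> X i j < 0) /\ (M i j = 0 -> X i j = 0).

Definition P0_matrix (R : realType) (m : nat) (M : 'M[R]_m) : Prop :=
  forall S : {set 'I_m}, S != set0 ->
    0 <= \det (mxsub (@enum_val _ (mem S)) (@enum_val _ (mem S)) M).

Fixpoint cyc_chain (R : realType) (k : nat) (n : 'I_k -> nat)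
    (B : forall j : 'I_k, 'M[R]_(n j, n (ordS j))) (i : 'I_k) (m : nat)
    : 'M[R]_(n i, n (iter m (@ordS k) i)) :=
  match m with
  | 0 => 1%:M
  | m'.+1 => cyc_chain B i m' *m B (iter m' (@ordS k) i)
  end.

Lemma iter_ordS_val k (i : 'I_k) m : val (iter m (@ordS k) i) = ((i + m) %% k)%N.
Proof.
elim: m => [|m IH] /=; first by rewrite addn0 modn_small.
by rewrite IH addnS -addn1 modnDml addn1.
Qed.

Lemma iter_ordS_k k (i : 'I_k) : iter k (@ordS k) i = i.
Proof. by apply: val_inj; rewrite iter_ordS_val modnDr modn_small. Qed.

Definition ord0k k (hk : (0 < k)%N) : 'I_k := Ordinal hk.

Definition cyc_prod (R : realType) (k : nat) (hk : (0 < k)%N) (n : 'I_k -> nat)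
    (B : forall j : 'I_k, 'M[R]_(n j, n (ordS j))) : 'M[R]_(n (ord0k hk)) :=
  castmx (erefl, congr1 n (iter_ordS_k (ord0k hk))) (cyc_chain B (ord0k hk) k).

(* Signed digraph G_{A^(0)...A^(k-1)}: vertex set = disjoint union of the V_j,
   vertex V_j^r is (Tagged _ r : {j : 'I_k & 'I_(n j)}).  The weight of the
   pair (u,v) is the entry (A^(j))_{r s} if u = V_j^r and v = V_{j+1}^s, and 0
   otherwise; there is an edge u -> v iff the weight is nonzero, with its sign. *)
Definition vert (k : nat) (n : 'I_k -> nat) := {j : 'I_k & 'I_(n j)}.

Definition gweight (R : realType) (k : nat) (n : 'I_k -> nat)
    (A : forall j : 'I_k, 'M[R]_(n j, n (ordS j))) (u v : vert n) : R :=
  match tag v =P ordS (tag u) with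
  | ReflectT e => A (tag u) (tagged u) (cast_ord (congr1 n e) (tagged v))
  | ReflectF _ => 0
  end.

Definition gedge (R : realType) (k : nat) (n : 'I_k -> nat)
    (A : forall j : 'I_k, 'M[R]_(n j, n (ordS j))) : rel (vert n) :=
  fun u v => gweight A u v != 0.

Definition dcycle (R : realType) (k : nat) (n : 'I_k -> nat)
    (A : forall j : 'I_k, 'M[R]_(n j, n (ordS j))) (c : seq (vert n)) : Prop :=
  [/\ c != [::], uniq c & cycle (gedge A) c].

Definition neg_edges (R : realType) (k : nat) (n : 'I_k -> nat)
    (A : forall j : 'I_k, 'M[R]_(n j, n (ordS j))) (c : seq (vert n)) : nat :=
  count (fun p => gweight A p.1 p.2 < 0) (zip c (rot 1 c)).

(* e-cycle: a directed cycle with k*r1 edges, r2 of them negative, and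
   (-1)^(r1+r2) = 1. *)
Definition e_cycle (R : realType) (k : nat) (n : 'I_k -> nat)
    (A : forall j : 'I_k, 'M[R]_(n j, n (ordS j))) (c : seq (vert n)) : Prop :=
  dcycle A c /\ (-1 : R) ^+ (size c %/ k + neg_edges A c) = 1.

Definition e_cycle_free (R : realType) (k : nat) (n : 'I_k -> nat)
    (A : forall j : 'I_k, 'M[R]_(n j, n (ordS j))) : Prop :=
  ~ exists c : seq (vert n), e_cycle A c.

(* Main.v *)
Require Import Defs.
From HB Require Import structures.
From mathcomp Require Import all_boot all_order all_algebra.
From mathcomp Require Import perm.
From mathcomp Require Import reals.
Import Order.TTheory GRing.Theory Num.Theory.
Local Open Scope ring_scope.
Set Implicit Arguments. Unset Strict Implicit. Unset Printing Implicit Defensive.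

(** Fix a set [S] of vertices of [V_0], and let [W] be the weighted adjacency
    matrix of the digraph of [B].  Take [W] on the rows of [S], [1 - W] on the
    rows outside [V_0], and identity rows on [V_0 \ S].  Eliminating the vertices
    outside [V_0] shows that the determinant of this matrix is the principal
    minor of [B^(0) ... B^(k-1)] on [S].  In its Leibniz expansion each nonzero
    term factors over the cycles of the permutation, which are trivial fixed
    points or cycles of the digraph; a cycle with [k r_1] edges, [r_2] of them
    negative, meets [V_0] in [r_1] vertices and so contributes the sign
    [- (-1)^(r_1 + r_2)].  Without e-cycles every term is thus nonnegative.
    Conversely, given an e-cycle [c], let [S] be its vertices in [V_0] and
    multiply every entry off [c] by a small [t > 0]: at [t = 0] the only
    surviving term is that of [c], which is negative, and the determinant is
    polynomial in [t]. *)

(** * Cyclic sequences as edge lists [zip c (rot 1 c)], the form used by [neg_edges] *)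

Lemma cycle_all_zip (T : Type) (e : rel T) (c : seq T) :
  cycle e c = all (fun p => e p.1 p.2) (zip c (rot 1 c)).
Proof.
case: c => [|x p] //=; rewrite rot1_cons.
by elim: p {1 3}x => [|y p IH] z //=; rewrite IH.
Qed.

Lemma map_fcycle (T : eqType) (f : T -> T) (c : seq T) :
  fcycle f c -> map f c = rot 1 c.
Proof.
rewrite cycle_all_zip; move: (size_rot 1 c); move: (rot 1 c) => d.
elim: c d => [|x c IH] [|y d] //= [sz] /andP[/eqP -> h].
by rewrite (IH d).
Qed.

Lemma fcycle_map (T : eqType) (f : T -> T) (c : seq T) :
  map f c = rot 1 c -> fcycle f c.
Proof.
rewrite cycle_all_zip => <-.
by elim: c => //= x c ->; rewrite eqxx.
Qed.

Lemma zip_fcycle (T : eqType) (f : T -> T) (c : seq T) :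
  fcycle f c -> zip c (rot 1 c) = [seq (x, f x) | x <- c].
Proof. by move/map_fcycle <-; elim: c => //= x c ->. Qed.

(** * Leibniz terms factored over the orbits of a permutation *)

Section Porbits.
Variables (T : finType) (s : {perm T}).

Lemma mem_porbits_eq (O : {set T}) x :
  O \in porbits s -> (porbit s x == O) = (x \in O).
Proof. by case/imsetP=> y _ ->; rewrite eq_porbit_mem. Qed.

Lemma big_porbits (R : Type) (idx : R) (op : Monoid.com_law idx) (F : T -> R) :
  \big[op/idx]_x F x =
  \big[op/idx]_(O in porbits s) \big[op/idx]_(x in O) F x.
Proof.
rewrite (partition_big (porbit s) (mem (porbits s))) /=; last first.
  by move=> x _; apply: imset_f.
by apply: eq_bigr => O hO; apply: eq_bigl => x; rewrite mem_porbits_eq.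
Qed.

(** [odd_perm] is the parity of [#|T|] plus the number of orbits. The orbit sizes add up to [#|T|],
    so each orbit [O] accounts for [#|O| + 1]. *)
Lemma sign_perm_porbits (R : comNzRingType) :
  (-1) ^+ s = \prod_(O in porbits s) (-1) ^+ #|O|.+1 :> R.
Proof.
rewrite /odd_perm -oddD signr_odd prodrXr.
congr (_ ^+ _); under eq_bigr => O _ do rewrite -addn1.
rewrite big_split /= sum1_card; congr (_ + _)%N.
rewrite -sum1_card big_porbits; apply: eq_bigr => O _; exact: sum1_card.
Qed.

Lemma leibniz_term_porbits (R : comNzRingType) (M : T -> T -> R) :
  (-1) ^+ s * \prod_i M i (s i) =
  \prod_(O in porbits s) ((-1) ^+ #|O|.+1 * \prod_(i in O) M i (s i)).
Proof. by rewrite big_split /= -sign_perm_porbits -big_porbits. Qed.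

Lemma porbit_fcycle (c : seq T) x : fcycle s c -> x \in c -> porbit s x =i c.
Proof.
move=> hc hx y; rewrite -(fconnect_cycle hc hx).
apply/porbitP/idP => [[i ->]|/iter_findex <-].
  by rewrite permX fconnect_iter.
by exists (findex s x y); rewrite permX.
Qed.

Lemma fcycle_porbit x : fcycle s (traject s x #|porbit s x|).
Proof.
apply: fcycle_map.
have := iter_porbit s x; have := card_porbit_neq0 s x.
case: #|_| => // m _ hx.
have ->: map s (traject s x m.+1) = traject s (s x) m.+1.
  by elim: m.+1 x {hx} => //= p IH y; rewrite IH.
by rewrite trajectSr -iterSr hx [in RHS]/= rot1_cons.
Qed.

End Porbits.

(** * Determinants indexed by a finite type *)

Section FinDet.
Variables (R : comNzRingType) (T : finType).
Implicit Types F G : T -> T -> R.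

(** Vertices form a sigma type, so an enumeration has to be chosen; [findet_reindex] shows that the
    choice is immaterial. *)
Definition findet F : R :=
  \det (\matrix_(i < #|T|, j < #|T|) F (enum_val i) (enum_val j)).

Lemma eq_findet F G : F =2 G -> findet F = findet G.
Proof. by move=> h; congr (\det _); apply/matrixP => i j; rewrite !mxE h. Qed.

(** Two numberings differ by one permutation applied to both rows and columns, and its two signs
    cancel. *)
Lemma findet_reindex m (h : 'I_m -> T) F :
  bijective h -> \det (\matrix_(i, j) F (h i) (h j)) = findet F.
Proof.
move=> hb; have e : m = #|T| by rewrite -(bij_eq_card hb) card_ord.
move: h hb; rewrite e => h hb.
have inj : injective (fun i => enum_rank (h i)).
  by move=> i j /enum_rank_inj /(bij_inj hb).
set M := \matrix_(i < #|T|, j < #|T|) F (enum_val i) (enum_val j).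
have -> : \matrix_(i, j) F (h i) (h j) = row_perm (perm inj) (col_perm (perm inj) M).
  by apply/matrixP => i j; rewrite !mxE !permE !enum_rankK.
rewrite row_permE col_permE !det_mulmx !det_perm odd_permV.
by rewrite mulrCA -signr_addb addbb mulr1.
Qed.

Lemma findet_mul F G :
  findet (fun u v => \sum_w F u w * G w v) = findet F * findet G.
Proof.
rewrite /findet -det_mulmx; congr (\det _); apply/matrixP => i j; rewrite !mxE.
rewrite (reindex (@enum_val _ (mem T))) /=; last first.
  exact/onW_bij/enum_val_bij.
by apply: eq_bigr => w _; rewrite !mxE.
Qed.

(** Working in the Leibniz expansion avoids sorting the indices by [f], which may take equal values:
    a permutation with a nonzero term never decreases [f], which forces it to be the identity. *)
Lemma findet_unitriangular (f : T -> nat) F :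
  (forall u, F u u = 1) ->
  (forall u v, F u v != 0 -> u != v -> (f u < f v)%N) ->
  findet F = 1.
Proof.
move=> h1 hlt; rewrite /findet /determinant (bigD1 (1%g : 'S_#|T|)) //=.
rewrite [X in _ * X]big1 => [|i _]; last by rewrite mxE perm1.
rewrite odd_perm1 mulr1 expr0 big1 ?addr0 // => s.
have [/existsP[i /eqP h0] _|] :=
  boolP [exists i, F (enum_val i) (enum_val (s i)) == 0].
  by rewrite (bigD1 i) //= mxE h0 mul0r mulr0.
rewrite negb_exists => /forallP hne /negP[]; apply/eqP/permP => i.
rewrite perm1; pose g (i : 'I_#|T|) := f (enum_val i).
have hle j : (g j <= g (s j) ?= iff (s j == j))%N.
  split.
    have [/eqP -> //|hj] := boolP (s j == j).
    apply/ltnW/hlt => //; apply: contra hj => /eqP/enum_val_inj h; apply/eqP.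
    by rewrite -h.
  have [->|hj] := eqVneq (s j) j; first exact: eqxx.
  apply/ltn_eqF/hlt => //; apply: contra hj => /eqP/enum_val_inj h; apply/eqP.
  by rewrite -h.
(* A permutation preserves [\sum f], so [f (s j) = f j] for every [j]. *)
have := leqif_sum (fun j (_ : xpredT j) => hle j).
have -> : (\sum_j g (s j) = \sum_j g j)%N.
  by rewrite [RHS](reindex_inj (@perm_inj _ s)).
case=> _; rewrite eqxx => /esym/forallP/(_ i).
by move/eqP.
Qed.

(** Numbering the image of [f] first makes the matrix block upper triangular, with an identity block
    at the lower right. *)
Lemma findet_restrict m (f : 'I_m -> T) F : injective f ->
  (forall u v, u \notin codom f -> F u v = (u == v)%:R) ->
  findet F = \det (\matrix_(i, j) F (f i) (f j)).
Proof.
move=> finj hF; pose C := [set u | u \notin codom f].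
pose h (i : 'I_(m + #|C|)) :=
  match split i with inl a => f a | inr b => enum_val b end.
have hC (b : 'I_#|C|) : enum_val b \notin codom f.
  by have := enum_valP b; rewrite inE.
have hl a : h (lshift _ a) = f a by rewrite /h (unsplitK (inl a)).
have hr b : h (rshift _ b) = enum_val b by rewrite /h (unsplitK (inr b)).
have hinj : injective h.
  move=> i j; rewrite -(splitK i) -(splitK j).
  case: (split i) (split j) => a [] b; rewrite /= ?hl ?hr.
  - by move/finj ->.
  - by move=> e; have := hC b; rewrite -e codom_f.
  - by move=> e; have := hC a; rewrite e codom_f.
  - by move/enum_val_inj ->.
have hb : bijective h.
  apply: inj_card_bij => //; rewrite card_ord -(cardC (mem (codom f))).
  rewrite card_codom // card_ord leq_add2l; apply/subset_leq_card/subsetP => x.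
  by rewrite !inE.
rewrite -(findet_reindex _ hb) -[RHS]mulr1 -(det1 R #|C|).
rewrite -(det_ublock _ (\matrix_(i, j) F (f i) (enum_val j))).
congr (\det _); apply/matrixP => i j.
rewrite -(splitK i) -(splitK j).
case: (split i) (split j) => a [] b; rewrite /= !mxE ?hl ?hr.
- by rewrite (unsplitK (inl a)) !mxE (unsplitK (inl b)) mxE.
- by rewrite (unsplitK (inl a)) !mxE (unsplitK (inr b)) mxE.
- rewrite (unsplitK (inr a)) !mxE (unsplitK (inl b)) mxE hF //.
  by case: eqP => // e; have := hC a; rewrite e codom_f.
- rewrite (unsplitK (inr a)) !mxE (unsplitK (inr b)) mxE hF //.
  by rewrite (inj_eq enum_val_inj).
Qed.

End FinDet.

(** * Perturbation of a negative determinant, and signs of products *)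

(** The determinant is a polynomial [q * 'X + \det M] in [e], and [q] is bounded on the unit
    interval. *)
Lemma det_affine_neg (R : realFieldType) m (M N : 'M[R]_m) :
  \det M < 0 -> exists2 e : R, 0 < e & \det (M + e *: N) < 0.
Proof.
move=> hM; pose P := map_mx polyC M + 'X *: map_mx polyC N.
have hP e : \det (M + e *: N) = (\det P).[e].
  rewrite -[RHS]/(horner_eval e _) -det_map_mx; congr (\det _).
  by apply/matrixP => i j; rewrite !mxE /= /horner_eval !hornerE.
have [q hq] : exists q, \det P = q * 'X + (\det M)%:P.
  have /factor_theorem[q hq] : root (\det P - (\det M)%:P) 0.
    by rewrite /root !hornerE -hP scale0r addr0 subrr.
  by exists q; rewrite subr0 in hq; rewrite -hq subrK.
have [b hb] := poly_itv_bound q 0 1.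
have b0 : 0 <= b.
  by apply: le_trans (normr_ge0 _) (hb 0 _); rewrite lexx ler01.
pose d := - \det M; have d0 : 0 < d by rewrite oppr_gt0.
have s0 : 0 < b + 1 + d by rewrite addr_gt0 // ltr_wpDl.
(* This value stays below 1, where the bound [b] on [q] applies, and satisfies [b * e < d]. *)
exists (d / (b + 1 + d)); first exact: divr_gt0.
set e := _ / _; have e0 : 0 <= e by rewrite ltW // divr_gt0.
have e1 : e <= 1 by rewrite ler_pdivrMr // mul1r lerDr ltW // ltr_wpDl.
rewrite hP hq hornerD hornerM hornerX hornerC -[\det M]opprK subr_lt0 -/d.
apply: le_lt_trans (_ : b * e < d).
  apply: ler_wpM2r => //; apply: le_trans (ler_norm _) (hb _ _).
  by rewrite e0 e1.
rewrite /e mulrCA gtr_pMr // ltr_pdivrMr // mul1r -addrA ltrDl.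
by rewrite addr_gt0.
Qed.

(** A pair contributes one sign if its source lies outside [Z] and one if its value is negative; a
    zero value makes both sides vanish. *)
Lemma prod_signed_pairs (R : realDomainType) (T : Type) (Z : pred T)
    (F : T -> T -> R) (c d : seq T) : size c = size d ->
  \prod_(p <- zip c d) (if Z p.1 then F p.1 p.2 else - F p.1 p.2) =
  (-1) ^+ (count (predC Z) c + count (fun p => F p.1 p.2 < 0) (zip c d))
    * \prod_(p <- zip c d) `|F p.1 p.2|.
Proof.
elim: c d => [|x c IH] [|y d] //= => [_|[/IH{}IH]]; first by rewrite !big_nil mulr1.
rewrite !big_cons IH /= [in RHS]addnACA [in RHS]exprD [RHS]mulrACA; congr (_ * _).
by rewrite exprD; case: ltrgt0P => [h|h|->]; case: (Z x);
  rewrite /= ?expr0 ?expr1 ?mulr1 ?mul1r ?mulN1r ?mulrN ?mulNr ?mul1r ?oppr0 ?opprK.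
Qed.

(** * Walks in the digraph and elimination of the vertices outside [V_0] *)

Section Graph.
Variables (R : realType) (k : nat) (hk : (0 < k)%N) (n : 'I_k -> nat).
Notation V := (vert n).
Notation z := (ord0k hk).
Notation tagv := (Tagged (fun j : 'I_k => 'I_(n j))).
Notation family := (forall j : 'I_k, 'M[R]_(n j, n (ordS j))).
Implicit Types (B : family) (u v w : V).

(** A nonzero index forces [k > 1]. Hence loops can occur only at [V_0]. *)
Lemma ordS_neq (j : 'I_k) : j != z -> ordS j != j.
Proof.
move=> hj; apply: contra hj => /eqP/(congr1 val) /= h; apply/eqP/val_inj => /=.
have := ltn_ord j; rewrite leq_eqVlt => /orP[/eqP e|lt].
  by rewrite -h e modnn.
by move: h; rewrite modn_small // => /eqP; rewrite eqn_leq ltnn.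
Qed.

Lemma iter_ordS0_eq (m : nat) : (m < k)%N ->
  (iter m.+1 (@ordS k) z == z) = (m.+1 == k).
Proof.
move=> lt; rewrite -val_eqE iter_ordS_val /= add0n.
move: lt; rewrite leq_eqVlt => /orP[/eqP ->|lt]; first by rewrite modnn !eqxx.
by rewrite modn_small // (ltn_eqF lt).
Qed.

Lemma gweight_tagv B j (r : 'I_(n j)) (s : 'I_(n (ordS j))) :
  gweight B (tagv r) (tagv s) = B j r s.
Proof.
rewrite /gweight; case: eqP => //= e.
by rewrite (eq_irrelevance e (erefl _)) /= cast_ord_id.
Qed.

Lemma gweight_out B u v : tag v != ordS (tag u) -> gweight B u v = 0.
Proof. by rewrite /gweight; case: eqP. Qed.

(** Case analysis that puts the target literally in the fibre over [ordS j], so that [gweight_tagv]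
    disposes of the cast in [gweight]. *)
Variant edge_spec u v : V -> V -> Prop :=
  | EdgeIn j (r : 'I_(n j)) (s : 'I_(n (ordS j))) : edge_spec u v (tagv r) (tagv s)
  | EdgeOut of tag v != ordS (tag u) : edge_spec u v u v.

Lemma edgeP u v : edge_spec u v u v.
Proof.
have [|h] := boolP (tag v == ordS (tag u)); last exact: EdgeOut.
case: u v => j r [j' s] /= /eqP e; move: s; rewrite e => s.
exact: (EdgeIn (existT _ j r) (existT _ (ordS j) s) r s).
Qed.

Lemma gedge_tag B u v : gedge B u v -> tag v = ordS (tag u).
Proof.
move=> h; apply/eqP; apply: contraTT h => /(gweight_out B).
by rewrite /gedge => ->; rewrite eqxx.
Qed.

Lemma qual_gweight A B : (forall j, qual (A j) (B j)) -> forall u v,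
  (gweight B u v < 0) = (gweight A u v < 0) /\
  (gweight B u v == 0) = (gweight A u v == 0).
Proof.
move=> hq u v; case: (edgeP u v) => [j r s|h]; last by rewrite !gweight_out.
rewrite !gweight_tagv; have [hp [hm h0]] := hq j r s.
case: (ltrgt0P (A j r s)) => h.
- by have := hp h; case: ltrgt0P.
- by have := hm h; case: ltrgt0P.
- by rewrite h0 // ltxx eqxx.
Qed.

Lemma sum_tag (M : nmodType) (F : V -> M) (j : 'I_k) :
  (forall w, tag w != j -> F w = 0) -> \sum_w F w = \sum_(r < n j) F (tagv r).
Proof.
move=> h; transitivity (\sum_i \sum_(r < n i) F (tagv r)).
  by rewrite sig_big_dep; apply: eq_bigr => -[].
rewrite (bigD1 j) //= [X in _ + X]big1 ?addr0 // => i hi.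
by rewrite big1 // => r _; apply: h.
Qed.

(* Weighted sum over the walks with [m.+1] edges whose inner vertices avoid [V_0]. *)
Fixpoint walk B (m : nat) u v : R :=
  match m with
  | 0 => gweight B u v
  | m'.+1 => \sum_w walk B m' u w * (if tag w == z then 0 else gweight B w v)
  end.

Lemma walk_out B m u v :
  tag v != iter m.+1 (@ordS k) (tag u) -> walk B m u v = 0.
Proof.
elim: m v => [|m IH] v /=; first exact: gweight_out.
move=> hv; apply: big1 => w _.
have [hw|/IH ->] := eqVneq (tag w) (iter m.+1 (@ordS k) (tag u)); last first.
  by rewrite mul0r.
by rewrite gweight_out ?if_same ?mulr0 // hw.
Qed.

(** A walk from [V_0] with at most [k] edges has its inner vertices in [V_1], ..., [V_m] with
    [m < k], so excluding [V_0] removes nothing and the sum is a plain matrix product. *)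
Lemma walk_chain B m (r : 'I_(n z)) (s : 'I_(n (iter m.+1 (@ordS k) z))) :
  (m < k)%N -> walk B m (tagv r) (tagv s) = cyc_chain B z m.+1 r s.
Proof.
elim: m s => [|m IH] s lt; first by rewrite /= mul1mx gweight_tagv.
rewrite [RHS]/= mxE [LHS]/= (@sum_tag _ _ (iter m.+1 (@ordS k) z)).
  apply: eq_bigr => q _; rewrite IH ?(ltnW lt) //=.
  have := iter_ordS0_eq (ltnW lt); rewrite (ltn_eqF lt) /= => ->.
  by rewrite gweight_tagv.
by move=> w hw; rewrite walk_out ?mul0r.
Qed.

Lemma cyc_prod_walk B (r s : 'I_(n z)) :
  cyc_prod hk B r s = walk B k.-1 (tagv r) (tagv s).
Proof.
have chain m (q : 'I_(n (iter m (@ordS k) z))) : (0 < m <= k)%N ->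
    walk B m.-1 (tagv r) (tagv q) = cyc_chain B z m r q.
  by case: m q => // m q /andP[_]; apply: walk_chain.
rewrite /cyc_prod castmxE cast_ord_id.
(* Transporting [s] back along the cast gives it the type that [chain] expects at [m = k]. *)
have -> : tagv s = tagv (cast_ord (esym (congr1 n (iter_ordS_k z))) s).
  move: (iter_ordS_k z) => e; move: (congr1 n e).
  by case: _ / (esym e) s => s e'; rewrite cast_ord_id.
by rewrite chain // hk leqnn.
Qed.

Definition base_set (S : {set 'I_(n z)}) : {set V} := [set tagv r | r in S].

Lemma mem_base_set S u : u \in base_set S -> tag u = z.
Proof. by case/imsetP => r _ ->. Qed.

(* Eliminating the rows and columns outside [V_0] from this matrix leaves the
   product of the [B j]; the rows of [V_0] outside [S] are made trivial. *)
Definition bordered (S : {set 'I_(n z)}) (W : V -> V -> R) u v : R :=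
  if u \in base_set S then W u v
  else (u == v)%:R - (if tag u == z then 0 else W u v).

(** The bordered matrix factors as [L * (1 - X)]: [X] holds the edges leaving vertices outside
    [V_0], and the rows of [L] on [S] sum the walks with 1 to [k] edges. The second factor is
    unitriangular, and [L] restricts to the minor. *)
Lemma principal_minor_findet B (S : {set 'I_(n z)}) :
  \det (mxsub (@enum_val _ (mem S)) (@enum_val _ (mem S)) (cyc_prod hk B)) =
  findet (bordered S (gweight B)).
Proof.
pose X w v : R := if tag w == z then 0 else gweight B w v.
pose L u w : R :=
  if u \in base_set S then \sum_(m < k) walk B m u w else (u == w)%:R.
have -> : findet (bordered S (gweight B)) =
    findet (fun u v => \sum_w L u w * ((w == v)%:R - X w v)).
  apply: eq_findet => u v; rewrite /bordered /L; case: ifP => hu.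
    under eq_bigr => w _ do rewrite mulr_suml.
    rewrite exchange_big /=.
    have step m : \sum_w walk B m u w * ((w == v)%:R - X w v) =
        walk B m u v - walk B m.+1 u v.
      under eq_bigr => w _ do rewrite mulrBr.
      rewrite sumrB; congr (_ - _); rewrite (bigD1 v) //= eqxx mulr1 big1 ?addr0 //.
      by move=> w /negPf ->; rewrite mulr0.
    under eq_bigr => m _ do rewrite step -opprB.
    (* The sum telescopes to [gweight B u v - walk B k u v]. The last term vanishes, because its
       walks would have to pass through [V_0] after [k] edges. *)
    rewrite sumrN -(big_mkord xpredT (fun m => walk B m.+1 u v - walk B m u v)).
    rewrite telescope_sumr // opprB -[LHS]subr0 /=; congr (_ - _).
    have walkS m : (0 < m)%N ->
        walk B m u v = \sum_w walk B m.-1 u w * X w v by case: m.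
    rewrite walkS //; apply/esym/big1 => w _; rewrite /X.
    have [_|hw] := eqVneq (tag w) z; first by rewrite mulr0.
    by rewrite walk_out ?mul0r // prednK // (mem_base_set hu) iter_ordS_k.
  rewrite (bigD1 u) //= eqxx mul1r big1 ?addr0 // => w.
  by rewrite eq_sym => /negPf ->; rewrite mul0r.
(* Vertices are ranked by their index, except that [V_0] comes last with rank [k]: its rows of [X]
   are zero, and the edges from [V_(k-1)] lead into it. *)
rewrite findet_mul [X in _ * X](@findet_unitriangular _ _
  (fun u => if tag u == z then k else val (tag u))); last 2 first.
- move=> u; rewrite /X eqxx; case: ifPn => hu; first by rewrite subr0.
  by rewrite gweight_out ?subr0 // eq_sym ordS_neq.
- move=> u v + /negPf hne; rewrite hne sub0r oppr_eq0 /X.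
  case: ifPn => [_|hu]; first by rewrite eqxx.
  move=> /(@gedge_tag B) ->; case: ifPn => [_|]; first exact: ltn_ord.
  have := ltn_ord (tag u); rewrite leq_eqVlt => /orP[/eqP e|lt].
    by rewrite -val_eqE /= e modnn.
  by rewrite /= modn_small.
rewrite mulr1 (@findet_restrict _ _ _ (fun i : 'I_#|S| => tagv (enum_val i))).
- congr (\det _); apply/matrixP => i j; rewrite !mxE /L imset_f ?enum_valP //.
  (* Of the walks summed in [L], only those with exactly [k] edges return to [V_0]. *)
  rewrite cyc_prod_walk; have lt : (k.-1 < k)%N by rewrite prednK.
  rewrite (bigD1 (Ordinal lt)) //= big1 ?addr0 // => m hm.
  rewrite walk_out // eq_sym [tag _]/= iter_ordS0_eq //.
  by apply: contra hm => /eqP hm; apply/eqP/val_inj; rewrite /= -[in RHS]hm.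
- by move=> i j /eqP; rewrite eq_Tagged /= => /eqP/enum_val_inj.
- move=> u v hu; rewrite /L; case: ifPn => // /imsetP[r hr e].
  case/negP: hu; apply/codomP; exists (enum_rank_in hr r).
  by rewrite enum_rankK_in.
Qed.

(** * Lengths and signs of directed cycles *)

(** Rotating [c] by one step applies [ordS] to all its indices, so [c] visits every [V_j] equally
    often. *)
Lemma size_dcycle B c : cycle (gedge B) c ->
  size c = (k * count (fun u => tag u == z) c)%N.
Proof.
move=> hc.
have tagE : [seq tag u | u <- rot 1 c] = [seq ordS (tag u) | u <- c].
  move: hc; rewrite cycle_all_zip; move: (size_rot 1 c); move: (rot 1 c) => d.
  by elim: c d => [|x c IH] [|y d] //= [sz] /andP[/gedge_tag -> h]; rewrite (IH d).
have cnt j : count (fun u => tag u == ordS j) c = count (fun u => tag u == j) c.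
  have /seq.permP pe : perm_eq (rot 1 c) c by rewrite perm_rot.
  rewrite -pe -(count_map tag (fun t => t == ordS j)) tagE count_map.
  by apply: eq_count => u /=; rewrite (inj_eq (@ordS_inj _)).
have cntz j : count (fun u => tag u == j) c = count (fun u => tag u == z) c.
  have -> : j = iter j (@ordS k) z.
    by apply: val_inj; rewrite iter_ordS_val /= add0n modn_small.
  by elim: (val j) => //= m <-; rewrite cnt.
set a := count _ c in cntz *; have -> : (k * a = \sum_(j < k) a)%N.
  by rewrite sum_nat_const card_ord.
under eq_bigr => j _ do rewrite -(cntz j) -sum1_count.
rewrite (exchange_big_dep xpredT) //= -sum1_size; apply: eq_bigr => u _.
by rewrite (big_pred1 (tag u)) // => j; rewrite eq_sym.
Qed.

(** With [l] edges, [r_1] vertices in [V_0] and [r_2] negative edges, the exponents [l + 1] and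
    [(l - r_1) + r_2] add up to the parity of [1 + r_1 + r_2]. *)
Lemma signed_dcycle_prod B c : cycle (gedge B) c ->
  (-1) ^+ (size c).+1 * \prod_(p <- zip c (rot 1 c))
    (if tag p.1 == z then gweight B p.1 p.2 else - gweight B p.1 p.2) =
  - (-1) ^+ (size c %/ k + neg_edges B c)
    * \prod_(p <- zip c (rot 1 c)) `|gweight B p.1 p.2|.
Proof.
move=> hc; rewrite (prod_signed_pairs (fun u => tag u == z)) ?size_rot //.
rewrite mulrA; congr (_ * _); rewrite -/(neg_edges B c).
rewrite -(count_predC (fun u => tag u == z) c) [in RHS]count_predC.
rewrite [in RHS](size_dcycle hc) mulKn // exprS mulN1r mulNr; congr (- _).
by rewrite -exprD -addnA addnCA addnA addnACA addnn exprD -mul2n exprM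
  sqrrN expr1n expr1n mul1r.
Qed.
End Graph.

Lemma prod_porbit_zip (R : comNzRingType) (I : finType) (T : Type) (s : {perm I})
    (O : {set I}) (c : seq I) (e : I -> T) (G : T -> T -> R) :
  fcycle s c -> uniq c -> O =i c ->
  \prod_(i in O) G (e i) (e (s i)) =
  \prod_(p <- zip (map e c) (rot 1 (map e c))) G p.1 p.2.
Proof.
move=> fc uc Oc; rewrite -map_rot -(map_fcycle fc) -map_comp zip_map big_map /=.
by rewrite big_uniq //=; apply: eq_bigl => i; rewrite Oc.
Qed.

(** * Absence of e-cycles makes the principal minors nonnegative *)

Section Main.
Variables (R : realType) (k : nat) (hk : (0 < k)%N) (n : 'I_k -> nat).
Notation V := (vert n).
Notation z := (ord0k hk).
Notation tagv := (Tagged (fun j : 'I_k => 'I_(n j))).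
Notation family := (forall j : 'I_k, 'M[R]_(n j, n (ordS j))).
Implicit Types (A B : family) (u v w : V).

Lemma qual_gedge A B : (forall j, qual (A j) (B j)) -> gedge B =2 gedge A.
Proof. by move=> hq u v; rewrite /gedge (qual_gweight hq u v).2. Qed.

Lemma qual_neg_edges A B c :
  (forall j, qual (A j) (B j)) -> neg_edges B c = neg_edges A c.
Proof. by move=> hq; apply: eq_count => p; rewrite (qual_gweight hq p.1 p.2).1. Qed.

Lemma e_cycle_qual A B c :
  (forall j, qual (A j) (B j)) -> e_cycle B c -> e_cycle A c.
Proof.
move=> hq [[c0 uc cc] he]; split; last by rewrite -(qual_neg_edges c hq).
by split; rewrite // -(eq_cycle (qual_gedge hq)).
Qed.

(** Either some entry on the orbit is zero, or the orbit is a fixed point outside [S] with entry 1,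
    or it traces a directed cycle, which is then an o-cycle. A fixed point in [S] falls under the
    last case, as a loop. *)
Lemma porbit_term_ge0 B (S : {set 'I_(n z)}) (s : 'S_#|{: V}|) i0 :
  e_cycle_free B ->
  0 <= (-1) ^+ #|porbit s i0|.+1 * \prod_(i in porbit s i0)
         bordered S (gweight B) (enum_val i) (enum_val (s i)).
Proof.
move=> free; set O := porbit s i0.
pose K i : R := bordered S (gweight B) (enum_val i) (enum_val (s i)).
have [/exists_inP[i iO /eqP K0]|] := boolP [exists i in O, K i == 0].
  by rewrite (bigD1 i) //= -/(K i) K0 mul0r mulr0.
move/exists_inPn => Kne.
have [/exists_inP[i iO /andP[/eqP si iS]]|] :=
    boolP [exists i in O, (s i == i) && (enum_val i \notin base_set S)].
  have -> : O = [set i].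
    have /eqP -> : O == porbit s i by rewrite eq_sym eq_porbit_mem.
    apply/setP => j; rewrite (@porbit_fcycle _ s [:: i]) ?inE //.
    by rewrite /= si eqxx.
  rewrite cards1 big_set1 si /bordered (negPf iS) eqxx sqrrN expr1n mul1r.
  case: ifPn => ht; first by rewrite subr0 ler01.
  by rewrite gweight_out ?subr0 ?ler01 // eq_sym ordS_neq.
move/exists_inPn => nofix.
(* With trivial fixed points excluded, the diagonal 1 of [bordered] no longer enters, and a nonzero
   entry is an edge weight up to sign. *)
have KE i : i \in O -> K i = if tag (enum_val i) == z
    then gweight B (enum_val i) (enum_val (s i))
    else - gweight B (enum_val i) (enum_val (s i)).
  move=> iO; have := nofix i iO; have := Kne i iO; rewrite /K /bordered.
  case: ifPn => [/mem_base_set -> _ _|_]; first by rewrite eqxx.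
  rewrite andbT => + /negPf si; rewrite (inj_eq enum_val_inj) [i == _]eq_sym si.
  by case: ifPn => _; rewrite ?subr0 ?eqxx // sub0r.
pose c0 := traject s i0 #|O|; pose c := [seq enum_val i | i <- c0].
have fc0 : fcycle s c0 := fcycle_porbit s i0.
have uc0 : uniq c0 := uniq_traject_porbit s i0.
have Oc0 : O =i c0 := porbit_traject s i0.
have szc : size c = #|O| by rewrite size_map size_traject.
have cc : cycle (gedge B) c.
  rewrite cycle_all_zip -map_rot -(map_fcycle fc0) -map_comp zip_map all_map.
  apply/allP => i; rewrite -Oc0 => iO /=; have := Kne i iO; rewrite KE //.
  by rewrite /gedge; case: ifP => _; rewrite ?oppr_eq0.
rewrite (eq_bigr _ KE) (prod_porbit_zip enum_val
  (fun u v => if tag u == z then gweight B u v else - gweight B u v) fc0 uc0 Oc0).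
rewrite -szc (signed_dcycle_prod hk cc); apply: mulr_ge0; last first.
  by apply: prodr_ge0 => p _.
rewrite -signr_odd; case: odd (@signr_odd R (size c %/ k + neg_edges B c)%N).
  by rewrite expr1 opprK.
move=> /esym he; case: free; exists c; split => //; split=> //.
  by rewrite -size_eq0 szc card_porbit_neq0.
by rewrite map_inj_uniq //; apply: enum_val_inj.
Qed.

Lemma e_cycle_free_P0 B : e_cycle_free B -> P0_matrix (cyc_prod hk B).
Proof.
move=> free S _; rewrite principal_minor_findet; apply: sumr_ge0 => s _.
rewrite leibniz_term_porbits; apply: prodr_ge0 => O /imsetP[i _ ->].
under eq_bigr => j _ do rewrite mxE.
exact: porbit_term_ge0.
Qed.

(** * An e-cycle yields a negative principal minor *)

Section Converse.
Variables (A : family) (c : seq V).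
Hypothesis ec : e_cycle A c.

Let uc : uniq c. Proof. by case: ec => [[]]. Qed.
Let cc : cycle (gedge A) c. Proof. by case: ec => [[]]. Qed.
Let c0 : c != [::]. Proof. by case: ec => [[]]. Qed.

Let scale (t : R) u v : R := if (u \in c) && (v == next c u) then 1 else t.

Let damped t : family :=
  fun j => \matrix_(r, s) (scale t (tagv r) (tagv s) * A j r s).

Let gweight_damped t u v : gweight (damped t) u v = scale t u v * gweight A u v.
Proof.
case: (edgeP u v) => [j r s|h]; last by rewrite !gweight_out // mulr0.
by rewrite !gweight_tagv mxE.
Qed.

Let qual_damped t : 0 < t -> forall j, qual (A j) (damped t j).
Proof.
move=> t0 j r s; rewrite mxE.
have s0 : 0 < scale t (tagv r) (tagv s) by rewrite /scale; case: ifP.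
by split; [|split] => h; rewrite ?pmulr_rgt0 ?pmulr_rlt0 ?h ?mulr0.
Qed.

Let S : {set 'I_(n z)} := [set r | tagv r \in c].

Let in_base u : (u \in base_set S) = (tag u == z) && (u \in c).
Proof.
apply/imsetP/andP => [[r + ->]|]; first by rewrite inE eqxx.
case: u => j r /= [/eqP e]; move: r; rewrite e => r hr; exists r => //.
by rewrite inE.
Qed.

(** By [size_dcycle], a cycle missing [V_0] would be empty. *)
Let S_neq0 : S != set0.
Proof.
have : has (fun u => tag u == z) c.
  have := size_dcycle hk cc; rewrite has_count.
  by case: (count _ c) => // /eqP; rewrite muln0 size_eq0 (negPf c0).
case/hasP => -[j r] /= rc /eqP e; move: r rc; rewrite e => r rc.
by apply/set0Pn; exists r; rewrite inE.
Qed.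

Let edge_next u : u \in c -> gedge A u (next c u).
Proof. exact: next_cycle cc. Qed.

Let M t := \matrix_(i < #|{: V}|, j < #|{: V}|)
  bordered S (gweight (damped t)) (enum_val i) (enum_val j).

Let next_perm_inj :
  injective (fun i : 'I_#|{: V}| => enum_rank (next c (enum_val i))).
Proof.
by move=> i j /enum_rank_inj /(can_inj (prev_next uc)) /enum_val_inj.
Qed.

(** [next c] is the identity off [c], so [s0] runs along [c] and fixes every other vertex. *)
Let s0 := perm next_perm_inj.

Let s0E i : enum_val (s0 i) = next c (enum_val i).
Proof. by rewrite permE enum_rankK. Qed.

Let cycle_damped0 : cycle (gedge (damped 0)) c.
Proof.
rewrite cycle_all_zip (zip_fcycle (cycle_next uc)) all_map; apply/allP => u hu /=.
by rewrite /gedge gweight_damped /scale hu eqxx mul1r; apply: edge_next.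
Qed.

Let neg_edges_damped0 : neg_edges (damped 0) c = neg_edges A c.
Proof.
rewrite /neg_edges (zip_fcycle (cycle_next uc)) !count_map.
apply: eq_in_count => u hu /=.
by rewrite gweight_damped /scale hu eqxx mul1r.
Qed.

(** The orbit along [c] contributes a negative factor because [c] is an e-cycle; all other orbits
    are fixed points with entry 1. *)
Let s0_term_lt0 : (-1) ^+ s0 * \prod_i M 0 i (s0 i) < 0.
Proof.
have [u0 u0c] : exists u, u \in c.
  by case: (c) c0 => // u l _; exists u; rewrite mem_head.
pose d := [seq enum_rank u | u <- c].
have dc : [seq enum_val i | i <- d] = c.
  by rewrite -map_comp map_id_in // => u _; apply: enum_rankK.
have ud : uniq d by rewrite map_inj_uniq //; apply: enum_rank_inj.
have fd : fcycle s0 d.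
  apply: fcycle_map; rewrite -map_rot -(map_fcycle (cycle_next uc)) -!map_comp.
  by apply: eq_map => u /=; rewrite permE enum_rankK.
have od x : x \in d -> porbit s0 x =i d := porbit_fcycle fd.
pose i0 := enum_rank u0; have i0d : i0 \in d by apply: map_f.
have memd i : (i \in d) = (enum_val i \in c).
  by rewrite -dc mem_map //; apply: enum_val_inj.
rewrite leibniz_term_porbits (bigD1 (porbit s0 i0)) /=; last exact: imset_f.
rewrite [X in _ * X]big1 ?mulr1.
  rewrite (eq_bigr (fun i => if tag (enum_val i) == z
      then gweight (damped 0) (enum_val i) (enum_val (s0 i))
      else - gweight (damped 0) (enum_val i) (enum_val (s0 i)))).
    rewrite (prod_porbit_zip enum_val (fun u v => if tag u == z
      then gweight (damped 0) u v else - gweight (damped 0) u v) fd ud (od _ i0d)).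
    have -> : #|porbit s0 i0| = size c.
      by rewrite (eq_card (od _ i0d)) (card_uniqP ud) size_map.
    rewrite dc (signed_dcycle_prod hk cycle_damped0) neg_edges_damped0.
    case: ec => _ ->; rewrite mulN1r oppr_lt0.
    rewrite big_seq; apply: prodr_gt0 => p hp; rewrite normr_gt0.
    by move: cycle_damped0; rewrite cycle_all_zip => /allP/(_ _ hp).
  move=> i; rewrite od // memd => ic; rewrite mxE /bordered in_base ic andbT.
  have [//|ht] := eqVneq (tag (enum_val i)) z; rewrite s0E.
  case: eqP => [e|_]; last by rewrite sub0r.
  by case/eqP: (ordS_neq ht); rewrite -(gedge_tag (edge_next ic)) -e.
move=> O /andP[/imsetP[i _ ->] hne].
have inc : enum_val i \notin c.
  apply: contra hne; rewrite -memd => id; apply/eqP/setP => j.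
  by rewrite od // od.
have si : s0 i = i by apply: enum_val_inj; rewrite s0E (next_nth) (negPf inc).
have -> : porbit s0 i = [set i].
  apply/setP => j; rewrite (@porbit_fcycle _ s0 [:: i]) ?inE //.
  by rewrite /= si eqxx.
rewrite cards1 big_set1 si mxE /bordered in_base (negPf inc) andbF eqxx.
rewrite gweight_damped /scale (negPf inc) mul0r if_same subr0.
by rewrite sqrrN expr1n mulr1.
Qed.

(** At [t = 0] a vertex off [c] must be fixed, and a vertex on [c] moves to its successor or,
    outside [V_0], may stay. Induction on the index rules out staying: vertices in [V_0] move, and a
    moving predecessor already occupies the place of its successor. *)
Let s0_unique (s : 'S_#|{: V}|) : (forall i, M 0 i (s i) != 0) -> s = s0.
Proof.
move=> hne.
have out i : enum_val i \notin c -> s i = i.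
  move=> ic; have := hne i; rewrite mxE /bordered in_base (negPf ic) andbF.
  rewrite gweight_damped /scale (negPf ic) mul0r if_same subr0.
  by rewrite (inj_eq enum_val_inj); case: (eqVneq i (s i)) => //; rewrite eqxx.
have step i : enum_val i \in c ->
    enum_val (s i) = next c (enum_val i) \/ (tag (enum_val i) != z /\ s i = i).
  move=> ic; have := hne i; rewrite mxE /bordered in_base ic andbT.
  rewrite gweight_damped /scale ic /=.
  have [->|nx] := eqVneq (enum_val (s i)) (next c (enum_val i)); first by left.
  rewrite mul0r if_same subr0; case: ifP => ht; first by rewrite eqxx.
  rewrite (inj_eq enum_val_inj).
  have [e _|_] := eqVneq i (s i); last by rewrite eqxx.
  by right.
have on m i : enum_val i \in c -> val (tag (enum_val i)) = m ->
    enum_val (s i) = next c (enum_val i).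
  elim: m i => [|m IH] i ic hm.
    by case: (step i ic) => // -[/eqP[]]; apply: val_inj.
  case: (step i ic) => // -[_ si].
  pose p := prev c (enum_val i); pose ip := enum_rank p.
  have pc : p \in c by rewrite mem_prev.
  have np : next c p = enum_val i by rewrite next_prev.
  have := gedge_tag (edge_next pc); rewrite np => tp.
  have vp : val (tag p) = m.
    move: hm; rewrite tp /=; have := ltn_ord (tag p).
    rewrite leq_eqVlt => /orP[/eqP ->|lt]; first by rewrite modnn.
    by rewrite modn_small // => -[].
  (* If [i] stayed fixed, it and its predecessor would have the same image, although their indices
     are [m + 1] and [m]. *)
  have sp : s ip = s i.
    apply: enum_val_inj; rewrite IH ?enum_rankK // np si //.
  have /(congr1 enum_val) := perm_inj sp; rewrite enum_rankK => e.
  by move: vp; rewrite e hm => /eqP; rewrite eqn_leq ltnn.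
apply/permP => i; apply: enum_val_inj; rewrite s0E.
have [ic|ic] := boolP (enum_val i \in c); first exact: (on _ i ic erefl).
by rewrite out // next_nth (negPf ic).
Qed.

Let det_M0_lt0 : \det (M 0) < 0.
Proof.
rewrite /determinant (bigD1 s0) //= [X in _ + X]big1 ?addr0 // => s hs.
have [/existsP[i /eqP h]|] := boolP [exists i, M 0 i (s i) == 0].
  by rewrite (bigD1 i) //= h mul0r mulr0.
by rewrite negb_exists => /forallP/s0_unique e; rewrite e eqxx in hs.
Qed.

Lemma e_cycle_not_P0 : exists2 B : family,
  (forall j, qual (A j) (B j)) & ~ P0_matrix (cyc_prod hk B).
Proof.
(* The bordered matrix is affine in [t], since [scale t] equals [scale 0 + t * (1 - scale 0)]. [N]
   is its slope, with the factors 1, 0 and -1 that [bordered] gives to the weights in its three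
   kinds of rows. *)
pose N := \matrix_(i < #|{: V}|, j < #|{: V}|)
  ((if enum_val i \in base_set S then 1 else if tag (enum_val i) == z then 0 else -1)
   * (1 - scale 0 (enum_val i) (enum_val j)) * gweight A (enum_val i) (enum_val j)).
have [t t0 ht] := det_affine_neg N det_M0_lt0.
exists (damped t); first exact: qual_damped.
move=> /(_ S S_neq0); rewrite principal_minor_findet leNgt => /negP; apply.
suff -> : findet (bordered S (gweight (damped t))) = \det (M 0 + t *: N) by [].
congr (\det _); apply/matrixP => i j; rewrite !mxE /bordered !gweight_damped /scale.
case: (enum_val i \in base_set S); case: (tag (enum_val i) == z);
  case: ((enum_val i \in c) && (enum_val j == next c (enum_val i)));
  by rewrite !(subrr, subr0, mul0r, mulr0, mul1r, mulr1, mulN1r,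
    oppr0, addr0, add0r, mulrN).
Qed.

End Converse.
End Main.
Unset Implicit Arguments.

Theorem theorem2 (R : realType) (k : nat) (hk : (0 < k)%N) (n : 'I_k -> nat)
    (hn : forall j, (0 < n j)%N)
    (A : forall j : 'I_k, 'M[R]_(n j, n (ordS j))) :
  (forall B : forall j : 'I_k, 'M[R]_(n j, n (ordS j)),
      (forall j, qual (A j) (B j)) -> P0_matrix (cyc_prod hk B))
  <-> e_cycle_free A.
Proof.
split=> [hP [c /(e_cycle_not_P0 hk)[B hB]]|free B hB]; first by apply; apply: hP.
apply: e_cycle_free_P0 => -[c ec]; apply: free; exists c.
exact: e_cycle_qual ec.
Qed.
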